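(* Let $K$ be a field of characteristic $0$ and let $V$ be a commutative associative (nonunital) $K$-algebra. Let $D=D_{(1+X)\ln(1+X)}$ be the unique coderivation of $(T(V),\Delta)$ such that $\pi\circ D=f_{(1+X)\ln(1+X)}$. Then the eigenspaces of $D$ give a gradation of the Hopf algebra $T(V)$ endowed with the quasi-shuffle product $\star$ and the deconcatenation coproduct $\Delta$: $T(V)=\bigoplus_{n\in\mathbb N}\ker(D-n\,\mathrm{Id})$, and this decomposition makes $(T(V),\star,\Delta)$ a graded Hopf algebra.
   Context: $T(V)=\bigoplus_{n\ge0}V^{\otimes n}$, elements $x_1\cdots x_n=x_1\otimes\cdots\otimes x_n$ are called words. The quasi-shuffle product $\star$ is defined inductively by $1\star v=v\star1=v$ and, for $a,b\in V$ and words $v,w$, $av\star bw=a(v\star bw)+b(av\star w)+(a\cdot b)(v\star w)$, where $a\cdot b$ is the product of $V$. The coproduct is $\Delta(x_1\cdots x_n)=\sum_{i=0}^nx_1\cdots x_i\otimes x_{i+1}\cdots x_n$. $\pi:T(V)\to V$ is the canonical projection. For a formal series $A=\sum_{n\ge1}a_nX^n$, $f_A:T(V)\to V$ is the linear map with $f_A(1)=0$ and $f_A(x_1\cdots x_n)=a_n\,(x_1\cdots x_n)_V$ (product in $V$). A coderivation is a linear map $D$ with $\Delta\circ D=(D\otimes\mathrm{Id}+\mathrm{Id}\otimes D)\circ\Delta$; for every linear $f:T(V)\to V$ there is a unique coderivation $D$ with $\pi\circ D=f$. Note $(1+X)\ln(1+X)=X+\sum_{i\ge2}\frac{(-1)^i}{i(i-1)}X^i$.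 *)

(* Defs.v *)
From HB Require Import structures.
From mathcomp Require Import all_boot all_algebra.
From mathcomp Require Import boolp freeg.

Set Implicit Arguments.
Unset Strict Implicit.
Unset Printing Implicit Defensive.

Import GRing.Theory.

Local Open Scope ring_scope.
Local Open Scope quotient_scope.

Section LinearQuotient.
Variables (K : fieldType) (M : lmodType K).
Implicit Types (S : M -> Prop) (c : K) (x y : M).

Inductive span S : M -> Prop :=
| span0 : span S 0
| span_comb c x y : S x -> span S y -> span S (c *: x + y).

Lemma span_gen S x : S x -> span S x.
Proof. by move=> Sx; rewrite -[x]addr0 -[x]scale1r; apply/span_comb/span0. Qed.

Lemma spanD S x y : span S x -> span S y -> span S (x + y).
Proof.
move=> Sx Sy; elim: Sx => [|c u v Su _ IH]; first by rewrite add0r.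
by rewrite -addrA; apply: span_comb.
Qed.

Lemma spanZ S c x : span S x -> span S (c *: x).
Proof.
elim=> [|d u v Su _ IH]; first by rewrite scaler0; apply: span0.
by rewrite scalerDr scalerA; apply: span_comb.
Qed.

(* Membership in a span is undecidable in general; [asbool] turns it into the
   boolean predicate expected by the quotient construction. *)
Definition in_span S (x : M) : bool := `[< span S x >].

Lemma in_span_zmod S : zmod_closed (in_span S).
Proof.
split=> [|x y /asboolP Sx /asboolP Sy]; apply/asboolP; first exact: span0.
by apply: spanD => //; rewrite -scaleN1r; apply: spanZ.
Qed.

HB.instance Definition _ S :=
  GRing.isZmodClosed.Build M (in_span S) (in_span_zmod S).

Definition span_closed S : zmodClosed M := GRing.ZmodClosed.clone M (in_span S) _.

Definition lquot S : Type := Quotient.quot (span_closed S).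

Section Structure.
Variable S : M -> Prop.

HB.instance Definition _ := GRing.Zmodule.on (lquot S).
HB.instance Definition _ := Quotient.on (lquot S).

Definition lclass x : lquot S := \pi_(Quotient.quot (span_closed S)) x.

Lemma lclass_eq x y : span S (x - y) -> lclass x = lclass y.
Proof.
move=> Sxy; apply/eqP; rewrite /lclass -Quotient.idealrBE.
exact/asboolP.
Qed.

Lemma lclass_span x y : lclass x = lclass y -> span S (x - y).
Proof. by move/eqP; rewrite /lclass -Quotient.idealrBE => /asboolP. Qed.

Lemma lclassK (q : lquot S) : lclass (repr q) = q.
Proof. exact: reprK. Qed.

Lemma lclassD x y : lclass (x + y) = lclass x + lclass y.
Proof. exact: Quotient.pi_add. Qed.

Definition lquot_scale c (q : lquot S) := lclass (c *: repr q).

Lemma lquot_scaleE c x : lquot_scale c (lclass x) = lclass (c *: x).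
Proof.
apply: lclass_eq; rewrite -scalerBr; apply/spanZ/lclass_span.
exact: lclassK.
Qed.

Lemma lquot_scaleA c d q :
  lquot_scale c (lquot_scale d q) = lquot_scale (c * d) q.
Proof. by rewrite -[q]lclassK !lquot_scaleE scalerA. Qed.

Lemma lquot_scale1 : left_id 1 lquot_scale.
Proof. by move=> q; rewrite -[q]lclassK lquot_scaleE scale1r. Qed.

Lemma lquot_scaleDr : right_distributive lquot_scale +%R.
Proof.
move=> c p q; rewrite -[p]lclassK -[q]lclassK.
by rewrite -lclassD !lquot_scaleE scalerDr lclassD.
Qed.

Lemma lquot_scaleDl q c d :
  lquot_scale (c + d) q = lquot_scale c q + lquot_scale d q.
Proof. by rewrite -[q]lclassK !lquot_scaleE scalerDl lclassD. Qed.

HB.instance Definition _ := GRing.Zmodule_isLmodule.Build K (lquot S)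
  lquot_scaleA lquot_scale1 lquot_scaleDr lquot_scaleDl.

Lemma lclass_is_linear : linear lclass.
Proof. by move=> c x y; rewrite lclassD -lquot_scaleE. Qed.

HB.instance Definition _ :=
  GRing.isLinear.Build K M (lquot S) _ lclass lclass_is_linear.

Lemma lclass0 x : S x -> lclass x = 0.
Proof.
move=> Sx; rewrite -(raddf0 lclass); apply/lclass_eq; rewrite subr0.
exact: span_gen.
Qed.

Variables (N : lmodType K) (f : {linear M -> N}).

Definition lq_lift of (forall x, S x -> f x = 0) :=
  fun q : lquot S => f (repr q).

Hypothesis fS : forall x, S x -> f x = 0.

Lemma lq_liftE x : lq_lift fS (lclass x) = f x.
Proof.
apply/eqP; rewrite -subr_eq0 -linearB; apply/eqP.
have: span S (repr (lclass x) - x) by apply/lclass_span/lclassK.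
elim=> [|c u v /fS fu _ fv]; first exact: linear0.
by rewrite linearP fu fv scaler0 addr0.
Qed.

Lemma lq_lift_is_linear : linear (lq_lift fS).
Proof.
move=> c p q; rewrite -[p]lclassK -[q]lclassK -linearP.
by rewrite !lq_liftE linearP.
Qed.

HB.instance Definition _ :=
  GRing.isLinear.Build K (lquot S) N _ (lq_lift fS) lq_lift_is_linear.

End Structure.
End LinearQuotient.

Section FreeLift.
Variables (K : fieldType) (X : choiceType) (N : lmodType K) (f : X -> N).

Lemma fglift_is_linear : linear (fglift f : {freeg X / K} -> N).
Proof.
move=> c D E; have fgliftD := lift_is_additive f.
have fD u v : fglift f (u + v) = fglift f u + fglift f v.
  have f0 : fglift f 0 = 0 by rewrite -(subrr 0) fgliftD subrr.
  by rewrite -{1}[v]opprK fgliftD -(sub0r v) fgliftD f0 sub0r opprK.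
rewrite fD; congr (_ + _).
have fsum (s : seq X) (F : X -> {freeg X / K}) :
    fglift f (\sum_(x <- s) F x) = \sum_(x <- s) fglift f (F x).
  elim: s => [|a s IH]; last by rewrite !big_cons fD IH.
  by rewrite !big_nil -(subrr 0) fgliftD subrr.
have -> : c *: D = \sum_(x <- dom D) << c * coeff x D *g x >> by [].
rewrite -[in RHS](freeg_sumE D) !fsum scaler_sumr.
apply: eq_bigr => x _.
by rewrite !liftU scalerA.
Qed.

HB.instance Definition _ := GRing.isLinear.Build K {freeg X / K} N _
  (fglift f : {freeg X / K} -> N) fglift_is_linear.

End FreeLift.

Lemma lquot_free_ext (K : fieldType) (X : choiceType)
    (S : {freeg X / K} -> Prop) (N : lmodType K) (f g : {linear lquot S -> N}) :
  (forall x : X, f (lclass S << x >>) = g (lclass S << x >>)) -> f =1 g.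
Proof.
move=> fg q; rewrite -[q]lclassK -[repr q]freeg_sumE !linear_sum.
apply: eq_bigr => x _; set c := coeff _ _.
have -> : << c *g x >> = c *: << x >> :> {freeg X / K}.
  by apply/eqP/freeg_eqP=> y; rewrite coeffZ !coeffU mul1r.
by rewrite !linearZ fg.
Qed.

Section Tensor.
Variables (K : fieldType) (U W : lmodType K).

Variant tensor_rel : {freeg (U * W)%type / K} -> Prop :=
| TensorRelL c u u' w : tensor_rel
    (<< (c *: u + u', w) >> - (c *: << (u, w) >> + << (u', w) >>))
| TensorRelR c u w w' : tensor_rel
    (<< (u, c *: w + w') >> - (c *: << (u, w) >> + << (u, w') >>)).

Definition tensor : Type := lquot tensor_rel.

HB.instance Definition _ := GRing.Lmodule.on tensor.

Definition tens (u : U) (w : W) : tensor := lclass tensor_rel << (u, w) >>.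

Lemma tens_bilinear : bilinear_for *:%R *:%R tens.
Proof.
by split=> [w c u u'|u c w w']; apply/eqP; rewrite -subr_eq0 -!linearP;
  rewrite -linearB; apply/eqP/lclass0; [left|right].
Qed.

HB.instance Definition _ :=
  bilinear_isBilinear.Build K U W tensor _ _ tens tens_bilinear.

Section Lift.
Variables (N : lmodType K) (f : {bilinear U -> W -> N}).

Lemma tens_lift_rel x : tensor_rel x -> fglift (fun p => f p.1 p.2) x = 0.
Proof.
by case=> *; rewrite linearB linearP /= !liftU !scale1r /=
  ?linearPl ?linearPr subrr.
Qed.

Definition tens_lift : tensor -> N := lq_lift tens_lift_rel.

HB.instance Definition _ := GRing.Linear.on tens_lift.

Lemma tens_liftE u w : tens_lift (tens u w) = f u w.
Proof. by rewrite [LHS]lq_liftE /= liftU scale1r. Qed.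

End Lift.

Lemma tensor_ext (N : lmodType K) (f g : {linear tensor -> N}) :
  (forall u w, f (tens u w) = g (tens u w)) -> f =1 g.
Proof. by move=> fg; apply: lquot_free_ext => -[u w]; apply: fg. Qed.

End Tensor.

Section TensorMaps.
Variable K : fieldType.

Section Map.
Variables (U U' W W' : lmodType K).
Variables (f : {linear U -> U'}) (g : {linear W -> W'}).

Definition tmap_fun u w := tens (f u) (g w).

Lemma tmap_fun_bilinear : bilinear_for *:%R *:%R tmap_fun.
Proof.
by split=> [w c u u'|u c w w']; rewrite /tmap_fun linearP ?linearPl ?linearPr.
Qed.

HB.instance Definition _ := bilinear_isBilinear.Build K U W (tensor U' W') _ _
  tmap_fun tmap_fun_bilinear.

Definition tmap : tensor U W -> tensor U' W' := tens_lift tmap_fun.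

HB.instance Definition _ := GRing.Linear.on tmap.

Lemma tmapE u w : tmap (tens u w) = tens (f u) (g w).
Proof. exact: tens_liftE. Qed.

End Map.

Section Assoc.
Variables U1 U2 U3 : lmodType K.

Section Inner.
Variable u3 : U3.

Definition tassoc_inner u1 u2 : tensor U1 (tensor U2 U3) :=
  tens u1 (tens u2 u3).

Lemma tassoc_inner_bilinear : bilinear_for *:%R *:%R tassoc_inner.
Proof.
by split=> [w c u u'|u c w w'];
  rewrite /tassoc_inner ?(linearPl, linearPr).
Qed.

HB.instance Definition _ := bilinear_isBilinear.Build K U1 U2 _ _ _
  tassoc_inner tassoc_inner_bilinear.

End Inner.

Definition tassoc_outer (t : tensor U1 U2) (u3 : U3) :=
  tens_lift (tassoc_inner u3) t.

Lemma tassoc_outer_bilinear : bilinear_for *:%R *:%R tassoc_outer.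
Proof.
split=> [w c u u'|t c w w']; rewrite /tassoc_outer; first exact: linearP.
pose h := [the {linear _ -> _} of tens_lift (tassoc_inner w)].
pose h' := [the {linear _ -> _} of tens_lift (tassoc_inner w')].
pose k := [the {linear _ -> _} of tens_lift (tassoc_inner (c *: w + w'))].
apply: (@tensor_ext _ _ _ _ k (c \*: h \+ h')) => u1 u2 /=.
by rewrite !tens_liftE /= /tassoc_inner !linearPr.
Qed.

HB.instance Definition _ := bilinear_isBilinear.Build K (tensor U1 U2) U3 _ _ _
  tassoc_outer tassoc_outer_bilinear.

Definition tassoc : tensor (tensor U1 U2) U3 -> tensor U1 (tensor U2 U3) :=
  tens_lift tassoc_outer.

HB.instance Definition _ := GRing.Linear.on tassoc.

Lemma tassocE u1 u2 u3 :
  tassoc (tens (tens u1 u2) u3) = tens u1 (tens u2 u3).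
Proof. by rewrite [LHS]tens_liftE /= /tassoc_outer tens_liftE. Qed.

End Assoc.

Section Unitors.
Variable U : lmodType K.

Definition scale_l (c : K^o) (u : U) : U := c *: u.
Definition scale_r (u : U) (c : K^o) : U := c *: u.

Lemma scale_l_bilinear : bilinear_for *:%R *:%R scale_l.
Proof.
split=> [u c a b|a c u v]; rewrite /scale_l; first by rewrite scalerDl -scalerA.
by rewrite scalerDr scalerA [X in X *: _]mulrC -scalerA.
Qed.

Lemma scale_r_bilinear : bilinear_for *:%R *:%R scale_r.
Proof. by split=> z; [apply: scale_l_bilinear.2|apply: scale_l_bilinear.1]. Qed.

HB.instance Definition _ :=
  bilinear_isBilinear.Build K K^o U U _ _ scale_l scale_l_bilinear.
HB.instance Definition _ :=
  bilinear_isBilinear.Build K U K^o U _ _ scale_r scale_r_bilinear.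

Definition tunitl : tensor K^o U -> U := tens_lift scale_l.
Definition tunitr : tensor U K^o -> U := tens_lift scale_r.

HB.instance Definition _ := GRing.Linear.on tunitl.
HB.instance Definition _ := GRing.Linear.on tunitr.

Lemma tunitlE c u : tunitl (tens c u) = c *: u.
Proof. exact: tens_liftE. Qed.

Lemma tunitrE u c : tunitr (tens u c) = c *: u.
Proof. exact: tens_liftE. Qed.

End Unitors.

Section Mul.
Variables (H : lmodType K) (m : {bilinear H -> H -> H}).

Section Inner.
Variables a b : H.

Definition tmul_inner c d := tens (m a c) (m b d).

Lemma tmul_inner_bilinear : bilinear_for *:%R *:%R tmul_inner.
Proof.
by split=> [w c u u'|u c w w']; rewrite /tmul_inner !(linearPl, linearPr).
Qed.

HB.instance Definition _ := bilinear_isBilinear.Build K H H _ _ _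
  tmul_inner tmul_inner_bilinear.

End Inner.

Section Outer.
Variable t : tensor H H.

Definition tmul_outer a b := tens_lift (tmul_inner a b) t.

Lemma tmul_outer_bilinear : bilinear_for *:%R *:%R tmul_outer.
Proof.
pose h a b := [the {linear _ -> _} of tens_lift (tmul_inner a b)].
split=> [w c u u'|u c w w']; rewrite /tmul_outer.
  apply: (@tensor_ext _ _ _ _ (h _ _) (c \*: h u w \+ h u' w)) => a b /=.
  by rewrite !tens_liftE /= /tmul_inner !linearPl.
apply: (@tensor_ext _ _ _ _ (h _ _) (c \*: h u w \+ h u w')) => a b /=.
by rewrite !tens_liftE /= /tmul_inner linearPl linearPr.
Qed.

HB.instance Definition _ := bilinear_isBilinear.Build K H H _ _ _
  tmul_outer tmul_outer_bilinear.

End Outer.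

(* The product (a (x) b) (c (x) d) = m a c (x) m b d. *)
Definition tmul (s t : tensor H H) : tensor H H := tens_lift (tmul_outer t) s.

Lemma tmulE a b c d :
  tmul (tens a b) (tens c d) = tens (m a c) (m b d).
Proof. by rewrite [LHS]tens_liftE /= /tmul_outer tens_liftE. Qed.

End Mul.

End TensorMaps.

Section TensorAlgebra.
Variables (K : fieldType) (V : lmodType K).
Implicit Types (c : K) (x y z : V) (p s w : seq V).

Definition multilinear (N : lmodType K) (f : seq V -> N) : Prop :=
  forall p s c x y,
    f (p ++ (c *: x + y) :: s) = c *: f (p ++ x :: s) + f (p ++ y :: s).

Variant word_rel : {freeg (seq V) / K} -> Prop :=
| WordRel p s c x y : word_rel
    (<< p ++ (c *: x + y) :: s >>
     - (c *: << p ++ x :: s >> + << p ++ y :: s >>)).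

(* The relations preserve the length of words, so this quotient is the direct
   sum over n of V^{(x) n}, the n-th summand being spanned by the words of
   length n; [word [:: x1; ..; xn]] is the tensor x1 (x) .. (x) xn. *)
Definition TV : Type := lquot word_rel.

HB.instance Definition _ := GRing.Lmodule.on TV.

Definition word w : TV := lclass word_rel << w >>.

Lemma word_multilinear : multilinear word.
Proof.
move=> p s c x y; apply/eqP; rewrite -subr_eq0 -!linearP -linearB.
by apply/eqP/lclass0; split.
Qed.

Section Lift.
Variables (N : lmodType K) (f : seq V -> N) (mf : multilinear f).

Lemma tv_lift_rel t : word_rel t -> fglift f t = 0.
Proof.
by case=> *; rewrite linearB linearP /= !liftU !scale1r mf subrr.
Qed.

Definition tv_lift : TV -> N := lq_lift tv_lift_rel.

HB.instance Definition _ := GRing.Linear.on tv_lift.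

Lemma tv_liftE w : tv_lift (word w) = f w.
Proof. by rewrite [LHS]lq_liftE /= liftU scale1r. Qed.

End Lift.

Lemma tv_ext (N : lmodType K) (f g : {linear TV -> N}) :
  (forall w, f (word w) = g (word w)) -> f =1 g.
Proof. exact: lquot_free_ext. Qed.

Definition tv_one : TV := word [::].

Lemma cons_word_multilinear x : multilinear (fun w => word (x :: w)).
Proof. by move=> p; apply: (word_multilinear (x :: p)). Qed.

(* Left concatenation t |-> x t with a letter. *)
Definition lcons x : TV -> TV := tv_lift (cons_word_multilinear x).

HB.instance Definition _ x := GRing.Linear.on (lcons x).

Lemma lcons_word x w : lcons x (word w) = word (x :: w).
Proof. exact: tv_liftE. Qed.

Lemma lcons_linear c x y t :
  lcons (c *: x + y) t = c *: lcons x t + lcons y t.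
Proof.
pose h z := [the {linear _ -> _} of lcons z].
apply: (@tv_ext _ (h _) (c \*: h x \+ h y)) => w /=.
by rewrite !lcons_word (word_multilinear [::]).
Qed.

Definition deconc_word w : tensor TV TV :=
  \sum_(i < (size w).+1) tens (word (take i w)) (word (drop i w)).

Lemma deconc_word_multilinear : multilinear deconc_word.
Proof.
move=> p s c x y; rewrite /deconc_word !size_cat /= scaler_sumr -big_split /=.
apply: eq_bigr => i _; rewrite !take_cat !drop_cat.
case: ltnP => _; first by rewrite word_multilinear linearPr.
case: (i - size p)%N => [|j] /=; last by rewrite word_multilinear linearPl.
by rewrite (word_multilinear [::]) linearPr.
Qed.

Definition deconc : TV -> tensor TV TV := tv_lift deconc_word_multilinear.

HB.instance Definition _ := GRing.Linear.on deconc.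

Lemma deconc_wordE w : deconc (word w) = deconc_word w.
Proof. exact: tv_liftE. Qed.

Definition counit_word w : K^o := (nilp w)%:R.

Lemma counit_word_multilinear : multilinear counit_word.
Proof. by case=> [|a p] s c x y; rewrite scaler0 addr0. Qed.

Definition counit : TV -> K^o := tv_lift counit_word_multilinear.

HB.instance Definition _ := GRing.Linear.on counit.

Definition proj_word w : V := if w is [:: x] then x else 0.

Lemma proj_word_multilinear : multilinear proj_word.
Proof.
by case=> [|a [|b p]] [|d s] c x y; rewrite /= ?scaler0 ?addr0.
Qed.

(* The projection onto the summand V. *)
Definition proj : TV -> V := tv_lift proj_word_multilinear.

HB.instance Definition _ := GRing.Linear.on proj.

Definition coderivation (D : {linear TV -> TV}) : Prop :=
  forall t, deconc (D t) = tmap D idfun (deconc t) + tmap idfun D (deconc t).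

End TensorAlgebra.

HB.mixin Record Lmodule_isComNUAlgebra (K : fieldType) V
    of GRing.Lmodule K V := {
  nmul : V -> V -> V;
  nmulA : associative nmul;
  nmulC : commutative nmul;
  nmul_bilinear : bilinear_for *:%R *:%R nmul
}.

(* Commutative associative K-algebras, not necessarily unital. *)
#[short(type="comNUAlgType")]
HB.structure Definition ComNUAlgebra (K : fieldType) :=
  {V of Lmodule_isComNUAlgebra K V & GRing.Lmodule K V}.

HB.instance Definition _ (K : fieldType) (V : comNUAlgType K) :=
  bilinear_isBilinear.Build K V V V _ _ (@nmul K V) nmul_bilinear.

Section QuasiShuffle.
Variables (K : fieldType) (V : comNUAlgType K).
Implicit Types (c : K) (a b x y : V) (p s u w : seq V).

Fixpoint qshuffle_word u : seq V -> TV V :=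
  if u is a :: u' then
    fix qsh_a w : TV V :=
      if w is b :: w' then
        lcons a (qshuffle_word u' w) + lcons b (qsh_a w')
          + lcons (nmul a b) (qshuffle_word u' w')
      else word u
  else fun w => word w.

Lemma qshuffle_cons a u b w :
  qshuffle_word (a :: u) (b :: w) =
    lcons a (qshuffle_word u (b :: w)) + lcons b (qshuffle_word (a :: u) w)
      + lcons (nmul a b) (qshuffle_word u w).
Proof. by []. Qed.

Lemma qshuffle_nil u : qshuffle_word u [::] = word u.
Proof. by case: u. Qed.

Lemma qshuffle_wordC u w : qshuffle_word u w = qshuffle_word w u.
Proof.
elim: u w => [|a u IHu] w; first by rewrite qshuffle_nil.
elim: w => [|b w IHw]; first by rewrite qshuffle_nil.
by rewrite !qshuffle_cons IHu IHw IHu nmulC [lcons b _ + _]addrC.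
Qed.

Fact comb_add3 (N : lmodType K) c (t1 t2 t3 t1' t2' t3' : N) :
  (c *: t1 + t1') + (c *: t2 + t2') + (c *: t3 + t3')
    = c *: (t1 + t2 + t3) + (t1' + t2' + t3').
Proof. by rewrite !scalerDr (addrACA (c *: t1) t1') (addrACA _ (t1' + t2')). Qed.

Lemma qshuffle_multilinear u : multilinear (qshuffle_word u).
Proof.
elim: u => [|a u IHu]; first exact: word_multilinear.
elim=> [|b p IHp] s c x y.
  rewrite [LHS]qshuffle_cons (IHu [::]).
  have -> : nmul a (c *: x + y) = c *: nmul a x + nmul a y.
    exact: nmul_bilinear.2.
  rewrite !lcons_linear [lcons a _]linearP /=.
  by rewrite comb_add3.
rewrite !cat_cons !qshuffle_cons -!cat_cons IHu IHp IHu.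
rewrite [lcons a _]linearP [lcons b _]linearP [lcons (nmul a b) _]linearP /=.
by rewrite comb_add3.
Qed.

Lemma qshuffle_lift_multilinear (t : TV V) :
  multilinear (fun u => tv_lift (qshuffle_multilinear u) t).
Proof.
move=> p s c x y.
pose h u := [the {linear _ -> _} of tv_lift (qshuffle_multilinear u)].
apply: (@tv_ext _ _ _ (h _) (c \*: h (p ++ x :: s) \+ h (p ++ y :: s))) => w /=.
by rewrite !tv_liftE !(qshuffle_wordC _ w) qshuffle_multilinear.
Qed.

Definition qshuffle (t t' : TV V) : TV V :=
  tv_lift (qshuffle_lift_multilinear t') t.

Lemma qshuffle_wordE u w :
  qshuffle (word u) (word w) = qshuffle_word u w.
Proof. by rewrite /qshuffle !tv_liftE. Qed.

Lemma qshuffle_bilinear : bilinear_for *:%R *:%R qshuffle.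
Proof.
split=> [t c t1 t2|t c t1 t2]; first exact: linearP.
pose h t' := [the {linear _ -> _} of tv_lift (qshuffle_lift_multilinear t')].
apply: (@tv_ext _ _ _ (h _) (c \*: h t1 \+ h t2)) => w /=.
by rewrite !tv_liftE linearP.
Qed.

HB.instance Definition _ := bilinear_isBilinear.Build K _ _ _ _ _
  qshuffle qshuffle_bilinear.

(* The product in V of the letters of a word, with value 0 on the empty word. *)
Definition nprod w : V := if w is x :: s then foldl nmul x s else 0.

Lemma foldl_nmul_linear s c x y :
  foldl nmul (c *: x + y) s = c *: foldl nmul x s + foldl nmul y s.
Proof. by elim: s x y => //= a s IH x y; rewrite linearPl IH. Qed.

Lemma nprod_multilinear : multilinear nprod.
Proof.
case=> [|a p] s c x y /=; first exact: foldl_nmul_linear.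
by rewrite !foldl_cat /= linearPr foldl_nmul_linear.
Qed.

Section SeriesMap.
Variable A : nat -> K.

Definition series_word w : V := A (size w) *: nprod w.

Lemma series_word_multilinear : multilinear series_word.
Proof.
move=> p s c x y; rewrite /series_word nprod_multilinear !size_cat /=.
by rewrite scalerDr !scalerA mulrC.
Qed.

(* The linear map f_A attached to A = \sum_(n >= 1) A n X^n; it kills the empty
   word because [nprod [::] = 0]. *)
Definition series_map : TV V -> V := tv_lift series_word_multilinear.

HB.instance Definition _ := GRing.Linear.on series_map.

End SeriesMap.
End QuasiShuffle.

Section FormalSeries.
Variable K : fieldType.

(* A formal power series is given by its sequence of coefficients, and
   ln(1 + X) = \sum_(n >= 1) (-1)^(n+1) / n X^n. *)
Definition series_mul (A B : nat -> K) (n : nat) : K :=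
  \sum_(i < n.+1) A i * B (n - i)%N.

Definition series_1X (n : nat) : K := (n < 2)%:R.

Definition series_ln1X (n : nat) : K :=
  if n is 0 then 0 else (-1) ^+ n.+1 / n%:R.

End FormalSeries.

(* The subspace ker (D - n Id). *)
Definition ker_sub (K : fieldType) (M : lmodType K) (D : M -> M) (n : nat)
  (x : M) : Prop := D x - n%:R *: x = 0.

Section GradedHopf.
Variables (K : fieldType) (H : lmodType K).
Variables (m : {bilinear H -> H -> H}) (e : H).
Variables (Delta : {linear H -> tensor H H}) (eps : {linear H -> K^o}).
Variable S : {linear H -> H}.

Record hopf_algebra : Prop := HopfAlgebra {
  hopf_mulA : associative m;
  hopf_mul1 : left_id e m;
  hopf_mulr1 : right_id e m;
  hopf_coassoc : forall x,
    tassoc (tmap Delta idfun (Delta x)) = tmap idfun Delta (Delta x);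
  hopf_counitl : forall x, tunitl (tmap eps idfun (Delta x)) = x;
  hopf_counitr : forall x, tunitr (tmap idfun eps (Delta x)) = x;
  hopf_deltaM : forall x y, Delta (m x y) = tmul m (Delta x) (Delta y);
  hopf_delta1 : Delta e = tens e e;
  hopf_epsM : forall x y, eps (m x y) = eps x * eps y;
  hopf_eps1 : eps e = 1;
  hopf_antipodel : forall x, tens_lift m (tmap S idfun (Delta x)) = eps x *: e;
  hopf_antipoder : forall x, tens_lift m (tmap idfun S (Delta x)) = eps x *: e
}.

Variable E : nat -> H -> Prop.

Record direct_sum_decomposition : Prop := DirectSumDecomposition {
  dsum_subspace0 : forall n, E n 0;
  dsum_subspaceP : forall n c x y, E n x -> E n y -> E n (c *: x + y);
  dsum_total : forall x, exists N (h : nat -> H),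
    (forall n, E n (h n)) /\ x = \sum_(n < N) h n;
  dsum_direct : forall N (h : nat -> H), (forall n, E n (h n)) ->
    \sum_(n < N) h n = 0 -> forall n, (n < N)%N -> h n = 0
}.

Record graded_hopf_algebra : Prop := GradedHopfAlgebra {
  ghopf_hopf : hopf_algebra;
  ghopf_dsum : direct_sum_decomposition;
  ghopf_mul : forall i j x y, E i x -> E j y -> E (i + j)%N (m x y);
  ghopf_one : E 0%N e;
  ghopf_delta : forall n x, E n x ->
    span (fun t => exists i j a b,
            [/\ (i + j)%N = n, E i a, E j b & t = tens a b]) (Delta x);
  ghopf_eps : forall n x, E n x -> n != 0%N -> eps x = 0;
  ghopf_antipode : forall n x, E n x -> E n (S x)
}.

End GradedHopf.

(* Main.v *)
From HB Require Import structures.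
Require Import Defs.
From mathcomp Require Import all_boot all_algebra.
From mathcomp Require Import freeg zify ring.

(* A coderivation [D] is determined by [proj \o D], because an element of T(V)
   is recovered from its counit and from the image of its coproduct under
   [proj (x) id]. By induction on length, [D] is therefore a derivation of the
   quasi-shuffle product as soon as [f = proj \o D] satisfies
   [f (s ⋆ t) = eps s f t + eps t f s + f s . proj t + proj s . f t].
   For [f = f_A] this says that the coefficient of X^k Y^l in A(X + Y + X Y) is
   A_k [l <= 1] + A_l [k <= 1], which follows from the differential equation
   (1 + X) A' = A + 1 + X of A = (1 + X) ln (1 + X).
   As A_1 = 1, [D] multiplies a word of length n by n up to shorter words, so it
   is diagonalisable with eigenvalues in nat. The gradings of the product, the
   coproduct and the counit follow; the antipode [S] commutes with [D] because
   the convolution products of [S \o D] and of [D \o S] with [id] are both the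
   opposite of that of [S] with [D]. *)

Set Implicit Arguments.
Unset Strict Implicit.
Unset Printing Implicit Defensive.

Import GRing.Theory.

Local Open Scope ring_scope.

(** * Induction and extensionality on T(V) and on tensor products *)

Section Induction.
Variable K : fieldType.

Lemma lquot_free_ind (X : choiceType) (S : {freeg X / K} -> Prop)
    (P : lquot S -> Prop) :
  P 0 -> (forall c x y, P x -> P y -> P (c *: x + y)) ->
  (forall x, P (lclass S << x >>)) -> forall q, P q.
Proof.
move=> P0 PP Px q; rewrite -[q]lclassK -[repr q]freeg_sumE linear_sum.
elim: (dom _) => [|x s IH]; first by rewrite big_nil.
rewrite big_cons; set c := coeff _ _.
have -> : << c *g x >> = c *: << x >> :> {freeg X / K}.
  by apply/eqP/freeg_eqP=> y; rewrite coeffZ !coeffU mul1r.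
by rewrite linearZ; apply: PP; [apply: Px | apply: IH].
Qed.

Lemma tv_ind (V : lmodType K) (P : TV V -> Prop) :
  P 0 -> (forall c x y, P x -> P y -> P (c *: x + y)) ->
  (forall w, P (word w)) -> forall t, P t.
Proof. exact: lquot_free_ind. Qed.

Lemma tensor_ind (U W : lmodType K) (P : tensor U W -> Prop) :
  P 0 -> (forall c x y, P x -> P y -> P (c *: x + y)) ->
  (forall u w, P (tens u w)) -> forall t, P t.
Proof. by move=> P0 PP Pt; apply: lquot_free_ind => // -[u w]; apply: Pt. Qed.

Lemma linear_fun0 (M N : lmodType K) (f : M -> N) : linear f -> f 0 = 0.
Proof.
by move=> lf; have := lf (-1) 0 0; rewrite scaler0 addr0 scaleN1r addNr.
Qed.

Lemma linear_add_fun (M N : lmodType K) (f g : M -> N) :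
  linear f -> linear g -> linear (fun x => f x + g x).
Proof. by move=> lf lg c x y; rewrite lf lg scalerDr addrACA. Qed.

Lemma linear_opp_fun (M N : lmodType K) (f : M -> N) :
  linear f -> linear (fun x => - f x).
Proof. by move=> lf c x y; rewrite lf opprD scalerN. Qed.

Lemma linear_fun_sum (M N : lmodType K) (f : M -> N) (I : Type) (r : seq I)
    (F : I -> M) : linear f -> f (\sum_(i <- r) F i) = \sum_(i <- r) f (F i).
Proof.
move=> lf; elim: r => [|i r IH]; first by rewrite !big_nil linear_fun0.
by rewrite !big_cons -[F i]scale1r lf !scale1r IH.
Qed.

(** Linearity is a side condition on plain functions instead of part of a bundled map, so this
    applies to any goal once [t] is generalised; [lin] below discharges the side conditions. *)
Lemma tv_eq (V N : lmodType K) (f g : TV V -> N) :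
  (forall w, f (word w) = g (word w)) -> linear f -> linear g -> f =1 g.
Proof.
move=> fg lf lg; apply: tv_ind => [|c x y fx fy|//].
  by rewrite !linear_fun0.
by rewrite lf lg fx fy.
Qed.

Lemma tensor_eq (U W N : lmodType K) (f g : tensor U W -> N) :
  (forall u w, f (tens u w) = g (tens u w)) -> linear f -> linear g -> f =1 g.
Proof.
move=> fg lf lg; apply: tensor_ind => [|c x y fx fy|//].
  by rewrite !linear_fun0.
by rewrite lf lg fx fy.
Qed.

End Induction.

(** * Bilinearity of the product on the tensor square *)

Section TensorMul.
Variables (K : fieldType) (H : lmodType K) (m : {bilinear H -> H -> H}).

Lemma tmul_bilinear : bilinear_for *:%R *:%R (tmul m).
Proof.
split=> [t c s s'|s c t t']; rewrite /tmul; first exact: linearP.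
have tl (x : tensor H H) : linear (fun t => tens_lift (tmul_outer m t) x).
  move=> d y z; move: x; apply: tensor_eq => [u w||].
  - by rewrite !tens_liftE /= /tmul_outer linearP.
  - exact: linearP.
  apply: linear_add_fun => e x x'; rewrite linearP //.
  by rewrite scalerDr !scalerA mulrC.
exact: tl.
Qed.

HB.instance Definition _ := bilinear_isBilinear.Build K _ _ _ _ _
  (tmul m) tmul_bilinear.

End TensorMul.

(** * Closure rules for linear maps *)

Section LinearComp.
Variables (K : fieldType) (M N P Q : lmodType K).

Lemma linear_id : linear (fun x : M => x). Proof. by []. Qed.

Lemma linear_cst0 : linear (fun _ : M => 0 : N).
Proof. by move=> c x y; rewrite scaler0 addr0. Qed.

Lemma linear_compl (f : {linear N -> P}) (g : M -> N) :
  linear g -> linear (fun x => f (g x)).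
Proof. by move=> lg c x y; rewrite lg linearP. Qed.

Lemma linear_scalel (g : M -> K^o) (z : N) :
  linear g -> linear (fun x => g x *: z).
Proof. by move=> lg c x y; rewrite lg scalerDl -scalerA. Qed.

Lemma linear_bil_l (f : {bilinear N -> P -> Q}) (g : M -> N) z :
  linear g -> linear (fun x => f (g x) z).
Proof. by move=> lg c x y; rewrite lg linearPl. Qed.

Lemma linear_bil_r (f : {bilinear N -> P -> Q}) (g : M -> P) z :
  linear g -> linear (fun x => f z (g x)).
Proof. by move=> lg c x y; rewrite lg linearPr. Qed.

End LinearComp.

(* Without the opacity directive, unification unfolds the linear maps down to
   [repr]. *)
Ltac lin := intros; with_strategy opaque
  [tens tens_lift tmap tassoc tunitl tunitr tmul word lcons deconc counit proj
   qshuffle series_map]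
  solve [repeat lazymatch goal with
  | |- GRing.linear_for _ (fun x => x) => exact (@linear_id _ _)
  | |- GRing.linear_for _ (fun x => 0) => exact (@linear_cst0 _ _ _)
  | |- GRing.linear_for _ (fun x => @?f x + @?g x) => apply: linear_add_fun
  | |- GRing.linear_for _ (fun x => - @?g x) => apply: linear_opp_fun
  | |- _ => first [ exact (linearP _) | exact (linearPr _ _)
                  | apply: linear_scalel | apply: linear_bil_l
                  | apply: linear_bil_r | apply: linear_compl ]
  end].

(** * The quasi-shuffle bialgebra *)

Section Bialgebra.
Variables (K : fieldType) (V : comNUAlgType K).
Implicit Types (a b : V) (u v w : seq V) (s t : TV V).

Local Notation "s ⋆ t" := (@qshuffle K V s t) (at level 40).
Local Notation one := (tv_one V).

Lemma lcons_bilinear : bilinear_for *:%R *:%R (@lcons K V).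
Proof.
by split=> [t c a b|a c s t]; [apply: lcons_linear | apply: linearP].
Qed.

HB.instance Definition _ := bilinear_isBilinear.Build K _ _ _ _ _
  (@lcons K V) lcons_bilinear.

Lemma qshuffle_lcons a b s t :
  lcons a s ⋆ lcons b t =
    lcons a (s ⋆ lcons b t) + lcons b (lcons a s ⋆ t)
      + lcons (nmul a b) (s ⋆ t).
Proof.
move: s; apply: tv_eq; first move=> u.
move: t; apply: tv_eq; first move=> w.
by rewrite !lcons_word !qshuffle_wordE qshuffle_cons.
all: lin.
Qed.

Lemma qshuffle1l : left_id one (@qshuffle K V).
Proof.
apply: tv_eq; first move=> w.
by rewrite qshuffle_wordE.
all: lin.
Qed.

Lemma qshuffle1r : right_id one (@qshuffle K V).
Proof.
apply: tv_eq; first move=> w.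
by rewrite qshuffle_wordE qshuffle_nil.
all: lin.
Qed.

(** Applying the recursion twice gives nine terms; the three that begin with [a] recombine into
    [u ⋆ (B ⋆ C)]. The remaining seven are indexed by the nonempty subsets of the three leading
    letters. *)
Lemma qshuffle_expandr a b c (u v w : TV V) (A := lcons a u) (B := lcons b v)
    (C := lcons c w) :
  A ⋆ (B ⋆ C) =
    lcons a (u ⋆ (B ⋆ C)) + lcons b (A ⋆ (v ⋆ C)) + lcons c (A ⋆ (B ⋆ w))
    + lcons (nmul a b) (u ⋆ (v ⋆ C)) + lcons (nmul a c) (u ⋆ (B ⋆ w))
    + lcons (nmul b c) (A ⋆ (v ⋆ w)) + lcons (nmul a (nmul b c)) (u ⋆ (v ⋆ w)).
Proof.
rewrite [B ⋆ C]qshuffle_lcons !linearDr /= !qshuffle_lcons.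
by rewrite [LHS](AC (3*3*3) ((1*4*7)*2*5*3*6*8*9)).
Qed.

Lemma qshuffleC : commutative (@qshuffle K V).
Proof.
move=> s t; move: s; apply: tv_eq; first move=> u.
move: t; apply: tv_eq; first move=> w.
by rewrite !qshuffle_wordE qshuffle_wordC.
all: lin.
Qed.

Lemma qshuffleA : associative (@qshuffle K V).
Proof.
move=> s t r; move: s; apply: tv_eq; first move=> u.
move: t; apply: tv_eq; first move=> v.
move: r; apply: tv_eq; first move=> w.
elim: u v w => [|a u IHu] v w; first by rewrite !qshuffle1l.
elim: v w => [|b v IHv] w; first by rewrite qshuffle1l qshuffle1r.
elim: w => [|c w IHw]; first by rewrite !qshuffle1r.
rewrite -!lcons_word in IHv IHw *.
(* By commutativity the right side is the product of C with B ⋆ A, so the same expansion, with [a]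
   and [c] exchanged, serves both sides. *)
rewrite [RHS]qshuffleC [X in _ = _ ⋆ X]qshuffleC !qshuffle_expandr.
rewrite !lcons_word in IHv IHw *.
rewrite !IHu !IHv !IHw.
rewrite ![word (c :: w) ⋆ _]qshuffleC ![word w ⋆ _]qshuffleC.
rewrite ![word (b :: v) ⋆ word (a :: u)]qshuffleC.
rewrite ![word (b :: v) ⋆ word u]qshuffleC.
rewrite ![word v ⋆ word (a :: u)]qshuffleC ![word v ⋆ word u]qshuffleC.
rewrite [RHS](ACl (3*2*1*6*5*4*7)); do !congr (_ + _); congr lcons;
  by rewrite ?[nmul c _]nmulC // ?nmulA 1?[nmul b a]nmulC.
all: lin.
Qed.

Lemma counit_lcons a t : counit (lcons a t) = 0.
Proof.
move: t; apply: tv_eq; first move=> w.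
by rewrite lcons_word [LHS]tv_liftE.
all: lin.
Qed.

Lemma counit_word_cons a w : counit (word (a :: w)) = 0.
Proof. by rewrite -lcons_word counit_lcons. Qed.

Lemma counit1 : counit one = 1.
Proof. exact: tv_liftE. Qed.

Lemma counitM s t : counit (s ⋆ t) = counit s * counit t.
Proof.
have mul_linear f (g : K^o) :
    linear f -> linear (fun t : TV V => f t * g : K^o).
  by move=> lf c x y; rewrite lf mulrDl -scalerAl.
move: s; apply: (@tv_eq _ _ K^o (fun s => counit (s ⋆ t))
  (fun s => counit s * counit t)) => [u||]; last exact/mul_linear/linearP.
rewrite mulrC; move: t; apply: (@tv_eq _ _ K^o (fun t => counit (word u ⋆ t))
  (fun t => counit t * counit (word u))) => [w||];
    last exact/mul_linear/linearP.
rewrite mulrC.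
case: u => [|a u]; first by rewrite qshuffle1l counit1 mul1r.
case: w => [|b w]; first by rewrite qshuffle1r counit1 mulr1.
by rewrite -!lcons_word qshuffle_lcons !linearD /= !counit_lcons mulr0 !addr0.
all: lin.
Qed.

(** Either the cut comes before [a], or [a] stays in the left factor. This recursion replaces the
    sum over cuts in the inductions on words. *)
Lemma deconc_lcons a t :
  deconc (lcons a t) = tens one (lcons a t) + tmap (lcons a) idfun (deconc t).
Proof.
move: t; apply: tv_eq; first move=> w.
rewrite lcons_word !deconc_wordE /deconc_word big_ord_recl take0 drop0.
rewrite linear_sum; congr (_ + _); apply: eq_bigr => i _.
by rewrite /bump /= tmapE /= lcons_word.
all: lin.
Qed.

Lemma deconc1 : deconc one = tens one one.
Proof. by rewrite deconc_wordE /deconc_word big_ord1. Qed.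

Local Notation "s ⊛ t" := (tmul (@qshuffle K V) s t) (at level 40).

Lemma tmul_lcons_one a x t :
  tmap (lcons a) idfun x ⊛ tens one t = tmap (lcons a) idfun (x ⊛ tens one t).
Proof.
move: x; apply: tensor_eq; first move=> u v.
by rewrite tmapE !tmulE tmapE /= !qshuffle1r.
all: lin.
Qed.

Lemma tmul_one_lcons a x t :
  tens one t ⊛ tmap (lcons a) idfun x = tmap (lcons a) idfun (tens one t ⊛ x).
Proof.
move: x; apply: tensor_eq; first move=> u v.
by rewrite tmapE !tmulE tmapE /= !qshuffle1l.
all: lin.
Qed.

Lemma tmul_lcons a b x y (L := fun a => tmap (@lcons K V a) idfun) :
  L a x ⊛ L b y =
    L a (x ⊛ L b y) + L b (L a x ⊛ y) + L (nmul a b) (x ⊛ y).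
Proof.
rewrite /L; move: x; apply: tensor_eq; first move=> u v.
move: y; apply: tensor_eq; first move=> u' v'.
by rewrite !(tmapE, tmulE) /= qshuffle_lcons !linearDl.
all: lin.
Qed.

Lemma tmul1l x : tens one one ⊛ x = x.
Proof.
move: x; apply: tensor_eq; first move=> w w'.
by rewrite tmulE /= !qshuffle1l.
all: lin.
Qed.

Lemma tmul1r x : x ⊛ tens one one = x.
Proof.
move: x; apply: tensor_eq; first move=> w w'.
by rewrite tmulE /= !qshuffle1r.
all: lin.
Qed.

(** Prefixing a letter to the left tensor factor obeys the quasi-shuffle recursion ([tmul_lcons]).
    The terms with left factor 1 supply the cut before the first letter, so both sides satisfy the
    same recursion. *)
Lemma deconcM s t : deconc (s ⋆ t) = deconc s ⊛ deconc t.
Proof.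
move: s; apply: tv_eq; first move=> u.
move: t; apply: tv_eq; first move=> v.
elim: u v => [|a u IHu] v; first by rewrite qshuffle1l deconc1 tmul1l.
elim: v => [|b v IHv]; first by rewrite qshuffle1r deconc1 tmul1r.
rewrite -!lcons_word qshuffle_lcons !linearD /= !deconc_lcons.
move: IHv; rewrite -lcons_word => IHv; rewrite lcons_word IHu -lcons_word IHv.
rewrite !linearDl !linearDr /= IHu tmulE /= qshuffle1l qshuffle_lcons !linearDr
  /=.
rewrite tmul_lcons tmul_lcons_one tmul_one_lcons.
rewrite [deconc (lcons a _)]deconc_lcons [deconc (lcons b _)]deconc_lcons.
rewrite [_ (deconc (word u)) (_ + _)]linearDr.
rewrite [_ (_ + _) (deconc (word v))]linearDl /=.
rewrite [tmap (lcons a) _ (_ + _)]linearD [tmap (lcons b) _ (_ + _)]linearD /=.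
by rewrite [LHS](AC ((1*2)*(1*2)*2) (1*4*7*5*(2*(3*6*8)))).
all: lin.
Qed.

Lemma tassoc_lcons a x t :
  tassoc (tens (tmap (lcons a) idfun x) t) =
    tmap (lcons a) idfun (tassoc (tens x t))
      :> tensor (TV V) (tensor (TV V) (TV V)).
Proof.
move: x; apply: tensor_eq; first move=> x y.
by rewrite !(tmapE, tassocE).
all: lin.
Qed.

Lemma deconc_coassoc t :
  tassoc (tmap (@deconc K V) idfun (deconc t)) =
    tmap idfun (@deconc K V) (deconc t).
Proof.
have assoc_lcons a (x : tensor (TV V) (TV V)) :
  tassoc (tmap (@deconc K V) idfun (tmap (lcons a) idfun x))
    = tens one (tmap (lcons a) idfun x)
      + tmap (lcons a) idfun (tassoc (tmap (@deconc K V) idfun x)).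
  move: x; apply: tensor_eq; [move=> x y | lin | lin].
  by rewrite !tmapE /= deconc_lcons linearDl linearD /= tassocE tassoc_lcons.
have deconc_tmap a (x : tensor (TV V) (TV V)) :
  tmap idfun (@deconc K V) (tmap (lcons a) idfun x) =
    tmap (lcons a) idfun (tmap idfun (@deconc K V) x).
  move: x; apply: tensor_eq; [| lin | lin].
  by move=> x y; rewrite !tmapE.
move: t; apply: tv_eq; first elim=> [|a w IH].
- by rewrite !(deconc1, tmapE, tassocE) /= deconc1 tassocE.
- rewrite -lcons_word deconc_lcons !linearD /= !tmapE /= assoc_lcons
  deconc_tmap IH.
  by rewrite deconc1 tassocE deconc_lcons linearDr /= addrA.
all: lin.
Qed.

Lemma deconc_counitl t : tunitl (tmap (@counit K V) idfun (deconc t)) = t.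
Proof.
move: t; apply: tv_eq; first case=> [|a w].
  by rewrite deconc1 tmapE tunitlE /= counit1 scale1r.
rewrite -lcons_word deconc_lcons !linearD /= tmapE tunitlE /= counit1 scale1r.
rewrite -[RHS]addr0; congr (_ + _); move: (deconc _).
apply: tensor_eq; first move=> u v.
by rewrite !tmapE tunitlE /= counit_lcons scale0r.
all: lin.
Qed.

Lemma deconc_counitr t : tunitr (tmap idfun (@counit K V) (deconc t)) = t.
Proof.
move: t; apply: tv_eq; first elim=> [|a w IH].
  by rewrite deconc1 tmapE tunitrE /= counit1 scale1r.
rewrite -lcons_word deconc_lcons !linearD /= tmapE tunitrE /= counit_lcons
  scale0r.
rewrite add0r -[in RHS]IH; move: (deconc _).
apply: tensor_eq; first move=> u v.
by rewrite !tmapE !tunitrE /= linearZ.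
all: lin.
Qed.

Lemma proj_lcons a t : proj (lcons a t) = (counit t : K) *: a.
Proof.
move: t; apply: tv_eq; first move=> w.
rewrite lcons_word [LHS]tv_liftE [counit _]tv_liftE.
by case: w => [|b w] /=; rewrite ?scale1r ?scale0r.
all: lin.
Qed.

Lemma proj1 : proj one = 0.
Proof. exact: tv_liftE. Qed.

(** On a nonempty word, [proj] keeps only the cut after the first letter, and [lcons] glues the two
    pieces back together. *)
Lemma deconc_reconstruct t :
  t = (counit t : K) *: one
      + tens_lift (@lcons K V) (tmap (@proj K V) idfun (deconc t)).
Proof.
move: t; apply: tv_eq; first case=> [|a w].
  by rewrite deconc1 tmapE tens_liftE /= proj1 linear0l /= addr0 counit1
    scale1r.
rewrite -!lcons_word deconc_lcons linearD /= tmapE /= proj1 linear0l add0r.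
rewrite counit_lcons scale0r add0r -[in LHS](deconc_counitl (word w));
  move: (deconc _).
apply: tensor_eq; first move=> u v.
by rewrite !tmapE tunitlE tens_liftE /= proj_lcons linearZl_LR /= linearZ_LR.
all: lin.
Qed.
End Bialgebra.

(** * Convolution of endomorphisms and the antipode *)

Section Convolution.
Variables (K : fieldType) (V : comNUAlgType K).
Implicit Types (f g h : {linear TV V -> TV V}).

Local Notation "s ⋆ t" := (@qshuffle K V s t) (at level 40).
Local Notation one := (tv_one V).
Local Notation mult := (tens_lift (@qshuffle K V)).

Definition conv f g (t : TV V) : TV V := mult (tmap f g (deconc t)).

Lemma conv_is_linear f g : linear (conv f g).
Proof. by rewrite /conv; lin. Qed.

HB.instance Definition _ f g :=
  GRing.isLinear.Build K _ _ _ (conv f g) (conv_is_linear f g).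

Definition unit_counit (t : TV V) : TV V := (counit t : K) *: one.

Lemma unit_counit_is_linear : linear unit_counit.
Proof. by rewrite /unit_counit; lin. Qed.

HB.instance Definition _ :=
  GRing.isLinear.Build K _ _ _ unit_counit unit_counit_is_linear.

Lemma conv_ext f f' g g' : f =1 f' -> g =1 g' -> conv f g =1 conv f' g'.
Proof.
move=> ff gg t; rewrite /conv; congr (mult _); move: (deconc t).
by apply: tensor_eq; [move=> u v; rewrite !tmapE ff gg | lin | lin].
Qed.

Lemma conv_unitr f : conv f unit_counit =1 f.
Proof.
move=> t; rewrite -[in RHS](deconc_counitr t) /conv; move: (deconc t).
apply: tensor_eq; [move=> u v | lin | lin].
rewrite !tmapE tens_liftE tunitrE /= /unit_counit linearZ_LR /=.
by rewrite linearZr_LR /= qshuffle1r.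
Qed.

Lemma conv_unitl f : conv unit_counit f =1 f.
Proof.
move=> t; rewrite -[in RHS](deconc_counitl t) /conv; move: (deconc t).
apply: tensor_eq; [move=> u v | lin | lin].
rewrite !tmapE tens_liftE tunitlE /= /unit_counit linearZ_LR /=.
by rewrite linearZl_LR /= qshuffle1l.
Qed.

Lemma convA f g h : conv f (conv g h) =1 conv (conv f g) h.
Proof.
move=> t.
pose gh := [the {linear tensor (TV V) (TV V) -> TV V} of mult \o tmap g h].
have assoc_l p v :
    mult (tmap f g p) ⋆ h v = mult (tmap f gh (tassoc (tens p v))).
  move: p; apply: tensor_eq; [move=> a b | lin | lin].
  by rewrite tassocE !tmapE !tens_liftE /= tmapE tens_liftE qshuffleA.
have conv_l x : mult (tmap (conv f g) h x)
    = mult (tmap f gh (tassoc (tmap (@deconc K V) idfun x))).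
  move: x; apply: tensor_eq; [move=> u v | lin | lin].
  by rewrite !tmapE -assoc_l tens_liftE.
rewrite -[LHS]/(mult (tmap f (conv g h) (deconc t))).
rewrite [RHS]conv_l deconc_coassoc; move: (deconc t).
apply: tensor_eq; [move=> u v | lin | lin].
by rewrite !tmapE.
Qed.

Lemma conv_word f g w :
  conv f g (word w) =
    \sum_(i < size w) f (word (take i w)) ⋆ g (word (drop i w))
      + f (word w) ⋆ g one.
Proof.
rewrite /conv deconc_wordE /deconc_word !linear_sum /= big_ord_recr /=.
rewrite take_size drop_size tmapE tens_liftE; congr (_ + _).
by apply: eq_bigr => i _; rewrite tmapE tens_liftE.
Qed.

Section LeftInverse.
Variable f : {linear TV V -> TV V}.
Hypothesis f1 : f one = one.

(* Iterates [r |-> unit_counit - r * (f - unit_counit)]: the [n]-th iterate is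
   already the convolution inverse of [f] on words of length at most [n]. *)
Fixpoint conv_inv_approx n : {linear TV V -> TV V} :=
  if n is n'.+1 then
    let r := conv_inv_approx n' in
    [the {linear TV V -> TV V} of (unit_counit \- conv r f) \+ r]
  else [the {linear TV V -> TV V} of unit_counit].

(** The cut with empty suffix contributes [conv_inv_approx n (word w)], since [f one = one], and
    cancels the added iterate. Only proper prefixes remain, which is why the iterates stabilise. *)
Lemma conv_inv_approxS n w :
  conv_inv_approx n.+1 (word w) = unit_counit (word w) -
    \sum_(i < size w) conv_inv_approx n (word (take i w)) ⋆ f (word (drop i w)).
Proof. by rewrite /= conv_word f1 qshuffle1r opprD addrA subrK. Qed.

Lemma conv_inv_approx_stable n w :
  (size w <= n)%N ->
  conv_inv_approx n (word w) = conv_inv_approx (size w) (word w).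
Proof.
suff step m u : (size u <= m)%N ->
    conv_inv_approx m.+1 (word u) = conv_inv_approx m (word u).
  move=> /subnK <-; elim: (n - size w)%N => // k IH.
  by rewrite addSn step ?leq_addl.
elim: m u => [|m IH] u um.
  by case: u um => // _; rewrite conv_inv_approxS big_ord0 subr0.
rewrite !conv_inv_approxS; congr (_ - _); apply: eq_bigr => i _.
by rewrite IH // size_take ltn_ord -ltnS (leq_trans (ltn_ord i)).
Qed.

(** The limit of the iterates, taken at the first index where it is reached; it is multilinear
    because changing a letter keeps the length. *)
Definition conv_inv_word w : TV V := conv_inv_approx (size w) (word w).

Lemma conv_inv_word_multilinear : multilinear conv_inv_word.
Proof.
move=> p s c x y; rewrite /conv_inv_word word_multilinear !size_cat /=.
exact: linearP.
Qed.

Definition conv_inv : TV V -> TV V := tv_lift conv_inv_word_multilinear.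

HB.instance Definition _ := GRing.Linear.on conv_inv.

Lemma conv_inv_wordE w : conv_inv (word w) = conv_inv_word w.
Proof. exact: tv_liftE. Qed.

Lemma conv_inv1 : conv_inv one = one.
Proof.
by rewrite conv_inv_wordE /conv_inv_word /= /unit_counit counit1 scale1r.
Qed.

Lemma conv_invl : conv conv_inv f =1 unit_counit.
Proof.
apply: tv_eq; [move=> w | lin | lin].
rewrite conv_word f1 qshuffle1r /= conv_inv_wordE /conv_inv_word.
(* One further iterate leaves the value unchanged and exposes the recursion. *)
rewrite -(conv_inv_approx_stable (leqnSn _)) conv_inv_approxS.
rewrite [X in X + _](eq_bigr (fun i : 'I_(size w) =>
    conv_inv_approx (size w) (word (take i w)) ⋆ f (word (drop i w))));
      last first.
  move=> i _; rewrite /= conv_inv_wordE /conv_inv_word.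
  by rewrite -(@conv_inv_approx_stable (size w)) // size_take ltn_ord ltnW.
by rewrite addrC subrK.
Qed.

End LeftInverse.

Lemma antipode_exists : exists S : {linear TV V -> TV V},
  conv S idfun =1 unit_counit /\ conv idfun S =1 unit_counit.
Proof.
pose S := [the {linear TV V -> TV V} of conv_inv idfun].
have S1 : S one = one by exact: conv_inv1.
have Sid : conv S idfun =1 unit_counit by exact: conv_invl.
(* The left inverse of [S] is [id], by associativity. *)
exists S; split=> // t; rewrite -(conv_invl S1); apply: conv_ext => // u.
by rewrite -[LHS]conv_unitl -(conv_ext (conv_invl S1) (frefl _)) -convA
  (conv_ext (frefl _) Sid) conv_unitr.
Qed.
End Convolution.

(** * Coefficients of A(X + Y + X Y) *)

Section QuasiShuffleCoefficients.
Variable K : fieldType.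
Implicit Types (A B : nat -> K) (j k l : nat).

(* The coefficient of X^k Y^l in \sum_j A_j (X + Y + X Y)^j: each term of length
   j in the quasi-shuffle of words of lengths k and l contributes A_j. *)
Fixpoint qsh_coef k : (nat -> K) -> nat -> K :=
  if k is k'.+1 then
    fix qsh_k A l {struct l} :=
      if l is l'.+1 then
        qsh_coef k' (A \o succn) l + qsh_k (A \o succn) l'
          + qsh_coef k' (A \o succn) l'
      else A k
  else fun A => A.

Lemma qsh_coefSS A k l :
  qsh_coef k.+1 A l.+1 =
    qsh_coef k (A \o succn) l.+1 + qsh_coef k.+1 (A \o succn) l
      + qsh_coef k (A \o succn) l.
Proof. by []. Qed.

Lemma qsh_coef0 A k : qsh_coef k A 0 = A k.
Proof. by case: k. Qed.

Lemma qsh_coef_ext A B k l : A =1 B -> qsh_coef k A l = qsh_coef k B l.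
Proof.
elim: k A B l => [|k IHk] A B l AB; first exact: AB.
elim: l A B AB => [|l IHl] A B AB; first exact: AB.
have AB' : A \o succn =1 B \o succn by move=> j; apply: AB.
by rewrite !qsh_coefSS !(IHk _ _ _ AB') (IHl _ _ AB').
Qed.

Lemma qsh_coefD A B k l :
  qsh_coef k (A \+ B) l = qsh_coef k A l + qsh_coef k B l.
Proof.
elim: k A B l => // k IHk A B l; elim: l A B => // l IHl A B.
by rewrite !qsh_coefSS !IHk IHl; ring.
Qed.

(* The operator (1 + X) d/dX on formal series. *)
Definition series_euler A j : K := j.+1%:R * A j.+1 + j%:R * A j.

(** Moves the operator (1 + X) d/dX past the shift that the recursion of [qsh_coef] introduces, for
    the induction in the chain rule. *)
Lemma qsh_coef_euler_shift A k l (B := A \o succn) :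
  qsh_coef k (series_euler A \o succn) l =
    qsh_coef k (series_euler B) l + qsh_coef k B l + qsh_coef k (B \o succn) l.
Proof.
rewrite -!qsh_coefD; apply: qsh_coef_ext => j.
by rewrite /B /series_euler /= -!natr1; ring.
Qed.

(* Chain rule: if Z = X + Y + X Y, then (1 + X) dZ/dX = 1 + Z. *)
Lemma qsh_coef_euler A k l :
  qsh_coef k (series_euler A) l =
    k.+1%:R * qsh_coef k.+1 A l + k%:R * qsh_coef k A l.
Proof.
elim: k A l => [|k IHk] A l.
  rewrite mul0r addr0 mul1r; elim: l A => [|l IHl] A.
    by rewrite /= /series_euler mul0r addr0 mul1r.
  rewrite qsh_coefSS -IHl /= /series_euler /=.
  by rewrite -!natr1; ring.
elim: l A => [|l IHl] A; first by rewrite !qsh_coef0.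
rewrite [LHS]qsh_coefSS !qsh_coef_euler_shift !IHk IHl.
rewrite (qsh_coefSS A k.+1) (qsh_coefSS A k) (qsh_coefSS (A \o succn) k l).
by rewrite -!natr1; ring.
Qed.

Lemma qsh_coef_eq0 k l :
  qsh_coef k (fun j => (j == 0)%N%:R) l = ((k == 0)%N && (l == 0)%N)%:R.
Proof.
have qsh_coef_0 m n : qsh_coef m (fun=> 0) n = 0.
  elim: m n => // m IHm; elim=> // n IHn.
  by rewrite qsh_coefSS !IHm [X in _ + X + _]IHn !addr0.
case: k => [|k] //; elim: l => [|l IHl]; first by rewrite qsh_coef0.
by rewrite qsh_coefSS ![qsh_coef _ (_ \o _) _]qsh_coef_0 !addr0.
Qed.

(** The series 1 + X becomes 1 + X + Y + X Y = (1 + X)(1 + Y). *)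
Lemma qsh_coef_lt2 k l :
  qsh_coef k (fun j => (j < 2)%N%:R) l = ((k < 2)%N && (l < 2)%N)%:R.
Proof.
case: k => [|k] //; case: l => [|l]; first by rewrite qsh_coef0 andbT.
rewrite qsh_coefSS !(qsh_coef_ext (B := fun j => (j == 0)%N%:R)) ?qsh_coef_eq0.
  by rewrite /= andbF !add0r !ltnS !leqn0.
all: by case.
Qed.

Section LogSeries.
Hypothesis charK : [pchar K] =i pred0.

Let A := series_mul (@series_1X K) (@series_ln1X K).

Lemma xlog_coef0 : A 0 = 0.
Proof. by rewrite /A /series_mul big_ord1 /= mulr0. Qed.

Lemma xlog_coefS j : A j.+1 = series_ln1X K j.+1 + series_ln1X K j.
Proof.
rewrite /A /series_mul !big_ord_recl big1 => [|i _].
  by rewrite !mul1r addr0 subn0 /bump subn1.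
by rewrite /series_1X mul0r.
Qed.

Lemma series_euler_xlog : series_euler A =1 A \+ (fun j => (j < 2)%N%:R).
Proof.
have natK n : n.+1%:R * series_ln1X K n.+1 = (-1) ^+ n.
  by rewrite /= !exprS !mulN1r opprK mulrCA divff ?mulr1 //
    ((pcharf0P K).1 charK).
case=> [|j]; rewrite /series_euler ?xlog_coef0 !xlog_coefS.
  by rewrite mulrDr natK /= xlog_coef0 !mulr0 !addr0 add0r.
rewrite mulrDr natK exprS mulN1r -(natK j) -[RHS]/(A j.+1 + (j.+1 < 2)%:R)
  xlog_coefS.
(* Index 1 is treated apart: it is the last one to which 1 + X contributes, and [series_ln1X] takes
   the value 0 at 0. *)
case: j => [|j]; first by rewrite /= expr2 mulrNN mulr1 divr1; ring.
have: j.+2%:R * series_ln1X K j.+2 = - (j.+1%:R * series_ln1X K j.+1).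
  by rewrite !natK exprS mulN1r.
rewrite addr0; move: (series_ln1X K j.+1) (series_ln1X K j.+2) => x y e.
transitivity (y + x + (j.+2%:R * y + j.+1%:R * x));
  last by rewrite e addNr addr0.
by rewrite -!natr1; ring.
Qed.

(** In terms of series, A(X + Y + X Y) = A(X) (1 + Y) + A(Y) (1 + X), because ln((1 + X)(1 + Y)) =
    ln(1 + X) + ln(1 + Y). The chain rule and the differential equation of A give row k + 1 from row
    k after division by k + 1, which characteristic 0 allows. *)
Lemma qsh_coef_xlog k l :
  qsh_coef k A l = A k * (l < 2)%N%:R + A l * (k < 2)%N%:R.
Proof.
elim: k => [|k IHk]; first by rewrite xlog_coef0 mul0r add0r mulr1.
have natK_neq0 : k.+1%:R != 0 :> K by rewrite ((pcharf0P K).1 charK).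
apply: (mulfI natK_neq0).
have := qsh_coef_euler A k l.
rewrite (qsh_coef_ext _ _ series_euler_xlog) qsh_coefD IHk qsh_coef_lt2.
rewrite -mulnb natrM.
have : k.+1%:R * A k.+1 + k%:R * A k = A k + (k < 2)%N%:R :=
  series_euler_xlog k.
set T := (k < 2)%N%:R; set L := (l < 2)%N%:R => e1 e2.
(* The series B = 1 + X satisfies (1 + X) B' = B. *)
have eT : (1 - k%:R) * T = k.+1%:R * (k.+1 < 2)%N%:R :> K.
  rewrite /T; case: (k) => [|[|k']] /=; last by rewrite !mulr0.
    by rewrite subr0.
  by rewrite subrr mul0r mulr0.
transitivity ((A k + T - k%:R * A k) * L + A l * ((1 - k%:R) * T)).
  by rewrite -[LHS](addrK (k%:R * (A k * L + A l * T))) -e2; ring.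
by rewrite eT -e1; ring.
Qed.

End LogSeries.

End QuasiShuffleCoefficients.

(** * The maps f_A on quasi-shuffle products *)

Section SeriesQuasiShuffle.
Variables (K : fieldType) (V : comNUAlgType K).
Implicit Types (A : nat -> K) (a b x y : V) (u v w : seq V) (s t : TV V).

Local Notation "s ⋆ t" := (@qshuffle K V s t) (at level 40).
Local Notation one := (tv_one V).

Lemma foldl_nmulM x y w : foldl nmul (nmul x y) w = nmul (foldl nmul x w) y.
Proof.
elim: w x y => //= a w IH x y; rewrite -IH; congr foldl.
by rewrite -!nmulA [nmul y a]nmulC.
Qed.

Lemma foldl_nmul_insert x u b v :
  foldl nmul x (u ++ b :: v) = nmul (foldl nmul x (u ++ v)) b.
Proof. by rewrite !foldl_cat /= foldl_nmulM. Qed.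

Section SeriesMul.
Variables (A : nat -> K) (x : V).

(** As V has no unit, the product [x] of the letters already read is an accumulator, and the series
    is shifted by one for each letter. *)
Definition series_mul_word w : V := A (size w) *: foldl nmul x w.

Lemma series_mul_word_multilinear : multilinear series_mul_word.
Proof.
move=> p s c y z; rewrite /series_mul_word !size_cat /= !foldl_cat /= linearPr.
by rewrite foldl_nmul_linear scalerDr !scalerA mulrC.
Qed.

Definition series_mulmap : TV V -> V := tv_lift series_mul_word_multilinear.

HB.instance Definition _ := GRing.Linear.on series_mulmap.

End SeriesMul.

Lemma series_mulmap_lcons A x y t :
  series_mulmap A x (lcons y t) = series_mulmap (A \o succn) (nmul x y) t.
Proof.
move: t; apply: tv_eq; [move=> w | lin | lin].
by rewrite lcons_word ![LHS]tv_liftE [RHS]tv_liftE.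
Qed.

Lemma series_map_lcons A x t :
  series_map A (lcons x t) = series_mulmap (A \o succn) x t.
Proof.
move: t; apply: tv_eq; [move=> w | lin | lin].
by rewrite lcons_word ![LHS]tv_liftE [RHS]tv_liftE.
Qed.

Lemma series_mulmap_qshuffle A x u v :
  series_mulmap A x (word u ⋆ word v) =
    qsh_coef (size u) A (size v) *: foldl nmul x (u ++ v).
Proof.
elim: u A x v => [|a u IHu] A x v; first by rewrite qshuffle1l [LHS]tv_liftE.
elim: v A x => [|b v IHv] A x.
  by rewrite qshuffle1r [LHS]tv_liftE cats0 qsh_coef0.
rewrite -!lcons_word qshuffle_lcons !linearD /= !series_mulmap_lcons.
rewrite lcons_word IHu lcons_word IHv IHu -/(size _) !scalerDl.
rewrite foldl_nmulM !foldl_nmul_insert /= !foldl_nmulM.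
by rewrite [nmul a b]nmulC nmulA.
Qed.

Lemma series_map_qshuffle A a u b v :
  series_map A (word (a :: u) ⋆ word (b :: v)) =
    qsh_coef (size u).+1 A (size v).+1 *: foldl nmul a (u ++ b :: v).
Proof.
rewrite -!lcons_word qshuffle_lcons !linearD /= !series_map_lcons.
rewrite [lcons b _]lcons_word [lcons a _]lcons_word !series_mulmap_qshuffle.
by rewrite !foldl_nmul_insert /= [nmul b a]nmulC !foldl_nmulM -!scalerDl.
Qed.

Lemma projM s t :
  proj (s ⋆ t) = (counit s : K) *: proj t + (counit t : K) *: proj s
                 + nmul (proj s) (proj t).
Proof.
move: s; apply: tv_eq; [move=> u | lin | lin].
move: t; apply: tv_eq; [move=> v | lin | lin].
case: u => [|a u].
  rewrite qshuffle1l [counit (word [::])]counit1 scale1r.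
  by rewrite [proj (word [::])]proj1 scaler0 linear0l !addr0.
case: v => [|b v].
  rewrite qshuffle1r [counit (word [::])]counit1 scale1r.
  by rewrite [proj (word [::])]proj1 scaler0 linear0r add0r addr0.
rewrite -!lcons_word qshuffle_lcons !linearD /= !proj_lcons !counitM
  !counit_lcons.
by rewrite mulr0 mul0r !scale0r !add0r linearZr_LR linearZl_LR /= scalerA mulrC.
Qed.

Lemma series_map1 A : series_map A one = 0.
Proof. by rewrite [LHS]tv_liftE /series_word /= scaler0. Qed.

Section LogSeries.
Hypothesis charK : [pchar K] =i pred0.
Let F : TV V -> V := series_map (series_mul (@series_1X K) (@series_ln1X K)).

(** On nonempty words, each of the two terms of [qsh_coef_xlog] survives only if one of the words is
    a single letter, that is, equal to its own projection; on longer words [proj] vanishes as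
    well. *)
Lemma series_map_xlogM s t :
  F (s ⋆ t) = (counit s : K) *: F t + (counit t : K) *: F s
              + (nmul (F s) (proj t) + nmul (proj s) (F t)).
Proof.
rewrite /F.
move: s; apply: tv_eq; [move=> u | lin | lin].
move: t; apply: tv_eq; [move=> v | lin | lin].
case: u => [|a u].
  rewrite qshuffle1l [counit (word [::])]counit1 scale1r.
  by rewrite [proj (word [::])]proj1 [X in _ *: X]series_map1 scaler0
    series_map1 !linear0l !addr0.
case: v => [|b v].
  rewrite qshuffle1r [counit (word [::])]counit1 scale1r.
  by rewrite [proj (word [::])]proj1 [X in _ *: X]series_map1 scaler0
    series_map1 !linear0r add0r !addr0.
rewrite series_map_qshuffle qsh_coef_xlog // !counit_word_cons !scale0r !add0r.
rewrite ![series_map _ _]tv_liftE ![proj _]tv_liftE /series_word /= scalerDl.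
rewrite foldl_nmul_insert.
congr (_ + _).
  case: v => [|c v] /=; last by rewrite mulr0 scale0r linear0r.
  by rewrite mulr1 linearZl_LR cats0.
case: u => [|c u] /=; last by rewrite mulr0 scale0r linear0l.
rewrite mulr1 linearZr_LR /=; congr (_ *: _).
by rewrite -foldl_nmulM nmulC foldl_nmulM nmulC.
Qed.

End LogSeries.
End SeriesQuasiShuffle.

(** * The coderivation is a derivation of the quasi-shuffle product *)

Section LogDerivation.
Variables (K : fieldType) (V : comNUAlgType K).
Hypothesis charK : [pchar K] =i pred0.
Variable D : {linear TV V -> TV V}.
Hypothesis Dcoder : coderivation D.
Implicit Types (a b : V) (u v w : seq V) (s t : TV V).

Local Notation "s ⋆ t" := (@qshuffle K V s t) (at level 40).
Local Notation "x ⊛ y" := (tmul (@qshuffle K V) x y) (at level 40).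
Local Notation one := (tv_one V).

Definition tcoder (x : tensor (TV V) (TV V)) : tensor (TV V) (TV V) :=
  tmap D idfun x + tmap idfun D x.

Lemma tv_eq0 t :
  counit t = 0 -> tmap (@proj K V) idfun (deconc t) = 0 -> t = 0.
Proof.
by move=> t0 pt0; rewrite (deconc_reconstruct t) t0 pt0 scale0r linear0 addr0.
Qed.

(** Applying counit (x) counit to the coderivation identity gives c = c + c for c =
    [counit (D t)]. *)
Lemma counit_coder t : counit (D t) = 0.
Proof.
pose e x := tunitl (tmap (@counit K V) (@idfun (TV V)) x).
have counit_e x : counit (e (tcoder x)) =
    counit (D (tunitr (tmap idfun (@counit K V) x))) + counit (D (e x)).
  rewrite /tcoder /e; move: x; apply: (@tensor_eq _ _ _ K^o
    (fun x => counit (tunitl (tmap (@counit K V)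
      idfun (tmap D idfun x + tmap idfun D x))))
    (fun x => counit (D (tunitr (tmap idfun (@counit K V) x)))
              + counit (D (tunitl (tmap (@counit K V) idfun x)))));
    [move=> u v | lin | lin].
  rewrite !tmapE !linearD /= !tmapE !tunitlE tunitrE /= !linearZ /=.
  by congr (_ + _); apply: mulrC.
have := counit_e (deconc t).
rewrite /e /tcoder -Dcoder !deconc_counitl deconc_counitr -[LHS]addr0.
by move/addrI.
Qed.

Hypothesis piD : forall t : TV V,
  proj (D t) = series_map (series_mul (@series_1X K) (@series_ln1X K)) t.

Lemma coder1 : D one = 0.
Proof.
apply: tv_eq0; first exact: counit_coder.
rewrite Dcoder deconc1 !tmapE /= linearD /= !tmapE /=.
by rewrite piD series_map1 proj1 !linear0l addr0.
Qed.

Definition coder_defect s t := D (s ⋆ t) - (D s ⋆ t + s ⋆ D t).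

Definition tcoder_defect x y := tcoder (x ⊛ y) - (tcoder x ⊛ y + x ⊛ tcoder y).

Lemma tcoder_defect_tens (a b c d : TV V) :
  tcoder_defect (tens a b) (tens c d) =
    tens (coder_defect a c) (b ⋆ d) + tens (a ⋆ c) (coder_defect b d).
Proof.
rewrite /tcoder_defect /tcoder !(tmapE, tmulE) !linearDl !linearDr /= !tmulE.
rewrite /coder_defect linearNl linearNr linearDl linearDr /= !opprD.
by rewrite [LHS](AC (2*(2*2)) ((1*(3*5))*(2*(4*6)))).
Qed.

Lemma deconc_coder_defect s t :
  deconc (coder_defect s t) = tcoder_defect (deconc s) (deconc t).
Proof.
by rewrite /coder_defect /tcoder_defect linearB linearD /= !deconcM !Dcoder
  deconcM.
Qed.

Lemma counit_coder_defect s t : counit (coder_defect s t) = 0.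
Proof.
by rewrite linearB linearD /= !counitM !counit_coder mul0r mulr0 addr0 subrr.
Qed.

Lemma proj_coder_defect s t : proj (coder_defect s t) = 0.
Proof.
rewrite linearB linearD /= !projM !counit_coder !piD series_map_xlogM //.
rewrite !scale0r !add0r !addr0.
by rewrite [X in X - _](AC (2*2) ((2*3)*(1*4))) subrr.
Qed.

(** The summand whose first factor is a defect dies, as defects have zero projection. What remains
    is a defect of the second factors, which are suffixes when the tensors come from [deconc]. *)
Lemma tmap_proj_tcoder_defect (a b c d : TV V) :
  tmap (@proj K V) idfun (tcoder_defect (tens a b) (tens c d)) =
    tens (proj (a ⋆ c)) (coder_defect b d).
Proof.
by rewrite tcoder_defect_tens linearD /= !tmapE /= proj_coder_defect linear0l
  add0r.
Qed.

Lemma coder_deriv s t : D (s ⋆ t) = D s ⋆ t + s ⋆ D t.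
Proof.
move: s; apply: tv_eq; [move=> u | lin | lin].
move: t; apply: tv_eq; [move=> v | lin | lin].
apply/eqP; rewrite -subr_eq0 -/(coder_defect _ _); apply/eqP.
have [n] := ubnP (size u + size v).
elim: n u v => // n IH u v lt_uv.
apply: tv_eq0; first exact: counit_coder_defect.
rewrite deconc_coder_defect !deconc_wordE /deconc_word.
pose pd x y := tmap (@proj K V) idfun (tcoder_defect x y).
rewrite -/(pd _ _) (linear_fun_sum (f := fun x => pd x _)); last first.
  by rewrite /pd /tcoder_defect /tcoder; lin.
apply: big1 => i _; rewrite (linear_fun_sum (f := fun x => pd _ x)); last first.
  by rewrite /pd /tcoder_defect /tcoder; lin.
apply: big1 => j _; rewrite /pd tmap_proj_tcoder_defect.
(* If both prefixes are empty, the left factor is 1, which [proj] kills; otherwise the suffixes have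
   smaller total length and the induction hypothesis applies. *)
have [ij0|ij_gt0] := posnP (i + j).
  have /andP[/eqP-> /eqP->] : (i == 0 :> nat) && (j == 0 :> nat).
    by rewrite -addn_eq0 ij0.
  by rewrite !take0 qshuffle1l proj1 linear0l.
rewrite IH ?linear0r // !size_drop.
by have := ltn_ord i; have := ltn_ord j; lia.
Qed.

End LogDerivation.

(** * Finite sums of homogeneous elements and independence of eigenvectors *)

Section GradedSum.
Variables (K : fieldType) (M : lmodType K) (G : nat -> M -> Prop).
Hypothesis G0 : forall n, G n 0.
Hypothesis GP : forall n c x y, G n x -> G n y -> G n (c *: x + y).

Definition graded_sum N x : Prop :=
  exists h : nat -> M, (forall n, G n (h n)) /\ x = \sum_(n < N) h n.

Lemma graded_sum0 N : graded_sum N 0.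
Proof. by exists (fun=> 0); split=> //; rewrite big1. Qed.

Lemma graded_sumP N c x y :
  graded_sum N x -> graded_sum N y -> graded_sum N (c *: x + y).
Proof.
move=> [h [Gh ->]] [k [Gk ->]]; exists (fun n => c *: h n + k n).
by split=> [n|]; [apply: GP | rewrite scaler_sumr -big_split].
Qed.

Lemma graded_sum_single N n x : (n < N)%N -> G n x -> graded_sum N x.
Proof.
move=> nN Gx; exists (fun k => if k == n then x else 0); split=> [k|].
  by case: eqP => [->|].
rewrite (bigD1 (Ordinal nN)) //= eqxx big1 ?addr0 // => i /negbTE.
by rewrite -val_eqE /= => ->.
Qed.

Lemma graded_sum_sum N (I : Type) (r : seq I) (F : I -> M) :
  (forall i, graded_sum N (F i)) -> graded_sum N (\sum_(i <- r) F i).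
Proof.
move=> GF; elim: r => [|i r IH]; first by rewrite big_nil; apply: graded_sum0.
by rewrite big_cons -[F i]scale1r; apply: graded_sumP.
Qed.

Lemma graded_sum_widen N N' x :
  (N <= N')%N -> graded_sum N x -> graded_sum N' x.
Proof.
move=> NN' [h [Gh ->]]; apply: graded_sum_sum => i.
exact: graded_sum_single (leq_trans (ltn_ord i) NN') (Gh i).
Qed.

End GradedSum.

(** Applying N - f to the sum removes the term of index N and multiplies the n-th one by N - n,
    nonzero in characteristic 0 for n < N; induction on N concludes. *)
Lemma eigen_direct (K : fieldType) (M : lmodType K) (f : {linear M -> M})
    (charK : [pchar K] =i pred0) N (h : nat -> M) :
  (forall n, f (h n) = n%:R *: h n) -> \sum_(n < N) h n = 0 ->
  forall n, (n < N)%N -> h n = 0.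
Proof.
elim: N h => // N IH h fh sum0.
have hN n : (n < N)%N -> h n = 0.
  move=> nN; apply/eqP.
  have: (N%:R - n%:R) *: h n = 0.
    apply: (IH (fun n => (N%:R - n%:R) *: h n)) nN => [k|].
      by rewrite linearZ_LR /= fh !scalerA; congr (_ *: _); apply: mulrC.
    transitivity (N%:R *: (\sum_(k < N.+1) h k) - f (\sum_(k < N.+1) h k)).
      rewrite scaler_sumr linear_sum -sumrB big_ord_recr /= fh subrr addr0.
      by apply: eq_bigr => i _; rewrite fh scalerBl.
    by rewrite sum0 scaler0 linear0 subr0.
  move/eqP; rewrite scaler_eq0 -natrB; last exact: ltnW.
  by rewrite ((pcharf0P K).1 charK) subn_eq0 leqNgt nN.
move=> n; rewrite ltnS leq_eqVlt => /predU1P[->|]; last exact: hN.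
by move: sum0; rewrite big_ord_recr /= big1 ?add0r // => i _; apply: hN.
Qed.

(** * Triangularity of the coderivation with respect to length *)

Section Triangular.
Variables (K : fieldType) (V : comNUAlgType K).
Variable D : {linear TV V -> TV V}.
Hypothesis Dcoder : coderivation D.
Hypothesis piD : forall t : TV V,
  proj (D t) = series_map (series_mul (@series_1X K) (@series_ln1X K)) t.
Implicit Types (a b : V) (u v w : seq V) (s t : TV V).

Definition short n : TV V -> Prop :=
  Defs.span (fun t => exists2 w, (size w < n)%N & t = word w).

Lemma short_word n w : (size w < n)%N -> short n (word w).
Proof. by move=> wn; apply: span_gen; exists w. Qed.

Lemma short_lcons n a t : short n t -> short n.+1 (lcons a t).
Proof.
elim=> [|c x y [w wn ->] _ IH]; first by rewrite linear0; apply: span0.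
by rewrite linearP; apply: span_comb IH; exists (a :: w);
  [exact: wn | exact: lcons_word].
Qed.

(** Reconstruct [D (word (a :: w))] from its coproduct. The cut after [a] gives the first two terms,
    with D acting on the left or on the right factor; a longer prefix must be contracted by D to a
    single letter. *)
Lemma coder_word_cons a w :
  D (word (a :: w)) = word (a :: w) + lcons a (D (word w)) +
    \sum_(i < size w) lcons (proj (D (word (a :: take i.+1 w))))
                            (word (drop i.+1 w)).
Proof.
rewrite [LHS]deconc_reconstruct (counit_coder Dcoder) scale0r add0r Dcoder.
rewrite -lcons_word deconc_lcons !linearD /= !tmapE /= proj1.
rewrite (coder1 Dcoder piD).
rewrite !linear0 !linear0l !linear0 !add0r.
rewrite deconc_wordE /deconc_word !linear_sum /= -big_split big_ord_recl /=.
rewrite take0 drop0 !tmapE /= !tens_liftE /=.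
(* The coefficient of X in (1 + X) ln (1 + X) is 1. *)
have -> : proj (D (lcons a (word [::]))) = a.
  rewrite lcons_word piD [LHS]tv_liftE /series_word xlog_coefS /=.
  by rewrite expr2 mulrNN mulr1 divr1 addr0 scale1r.
rewrite proj_lcons counit1 scale1r lcons_word; congr (_ + _).
apply: eq_bigr => i _; rewrite /bump !tmapE /= !tens_liftE /= proj_lcons add1n.
(* These prefixes have at least two letters, so their own projection is 0 and D acting on the suffix
   contributes nothing. *)
have -> : counit (word (take i.+1 w)) = 0.
  by case: (w) i => [[]|b w' i] //=; rewrite counit_word_cons.
by rewrite scale0r linear0l addr0 [lcons a _]lcons_word.
Qed.

Lemma coder_triangular w : short (size w) (D (word w) - (size w)%:R *: word w).
Proof.
elim: w => [|a w IH].
  by rewrite (coder1 Dcoder piD) scale0r subrr; apply: span0.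
have -> : D (word (a :: w)) - (size (a :: w))%:R *: word (a :: w) =
    lcons a (D (word w) - (size w)%:R *: word w) +
    \sum_(i < size w) lcons (proj (D (word (a :: take i.+1 w))))
                            (word (drop i.+1 w)).
  rewrite coder_word_cons linearB /= [lcons a (_ *: _)]linearZ_LR /= lcons_word.
  rewrite -natr1 scalerDl scale1r.
  by rewrite opprD [LHS](AC (3*2) ((1*5)*(2*4)*3)) /= subrr add0r.
apply: spanD; first exact: short_lcons.
elim/big_ind: _ => [|x y|i _]; [exact: span0 | exact: spanD |].
by rewrite lcons_word; apply: short_word; rewrite /= size_drop;
  have := ltn_ord i; lia.
Qed.

End Triangular.

(** * The eigenspace decomposition and its compatibility with the Hopf structure *)

Section EigenGrading.
Variables (K : fieldType) (V : comNUAlgType K).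
Hypothesis charK : [pchar K] =i pred0.
Variable D : {linear TV V -> TV V}.
Hypothesis Dcoder : coderivation D.
Hypothesis piD : forall t : TV V,
  proj (D t) = series_map (series_mul (@series_1X K) (@series_ln1X K)) t.
Implicit Types (a b : V) (u v w : seq V) (s t : TV V).

Local Notation "s ⋆ t" := (@qshuffle K V s t) (at level 40).
Local Notation one := (tv_one V).
Local Notation E := (ker_sub D).

Lemma ker_subE n t : E n t <-> D t = n%:R *: t.
Proof.
by rewrite /ker_sub; split=> [/eqP|->]; rewrite ?subrr // subr_eq0 => /eqP.
Qed.

Lemma ker_sub0 n : E n 0.
Proof. by apply/ker_subE; rewrite linear0 scaler0. Qed.

Lemma ker_subP n c s t : E n s -> E n t -> E n (c *: s + t).
Proof.
move=> /ker_subE Ds /ker_subE Dt; apply/ker_subE.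
by rewrite linearP /= Ds Dt scalerDr !scalerA mulrC.
Qed.

(** If D w = n w + sum of h_i with D h_i = i h_i and i < n, then adding h_i / (n - i) for each i
    corrects w to an eigenvector, since 1 + i / (n - i) = n / (n - i). *)
Lemma word_graded_sum n :
  (forall t, short n t -> graded_sum E n t) ->
  forall w, size w = n -> graded_sum E n.+1 (word w).
Proof.
move=> short_sum w wn; have := coder_triangular Dcoder piD w.
rewrite wn => /short_sum[h [Eh eh]].
have nz i : (i < n)%N -> n%:R - i%:R != 0 :> K.
  by move=> lt_in; rewrite -natrB ?(ltnW lt_in) // ((pcharf0P K).1 charK)
    subn_eq0 -ltnNge.
(* [word w + z] is an eigenvector for [n]. *)
pose z := \sum_(i < n) (n%:R - i%:R)^-1 *: h i.
have -> : word w = (-1) *: z + (word w + z).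
  by rewrite scaleN1r addrCA addNr addr0.
apply: (graded_sumP ker_subP).
  apply: graded_sum_sum; [exact: ker_sub0 | exact: ker_subP |] => i.
  rewrite -[_ *: _]addr0; apply: (graded_sumP ker_subP);
    last exact: (graded_sum0 ker_sub0).
  by apply: (graded_sum_single ker_sub0 _ (Eh i)); rewrite ltnS ltnW.
apply: (graded_sum_single ker_sub0 (ltnSn n)); apply/ker_subE.
rewrite linearD scalerDr /= -[D (word w)](subrK (n%:R *: word w)) eh.
rewrite addrAC addrC; congr (_ + _).
rewrite linear_sum scaler_sumr -big_split; apply: eq_bigr => i _ /=.
rewrite linearZ_LR /= ((ker_subE _ _).1 (Eh i))
  !scalerA -{1}[h i]scale1r -scalerDl.
by congr (_ *: _); field; apply: nz.
Qed.

Lemma short_graded_sum n t : short n t -> graded_sum E n t.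
Proof.
elim: n t => [|n IH] t; elim=> [|c x y [w wn ->] _ sum_y];
  do ?exact: (graded_sum0 ker_sub0); first by [].
apply: (graded_sumP ker_subP) sum_y.
have [lt_wn|ge_wn] := ltnP (size w) n.
  apply: (graded_sum_widen ker_sub0 ker_subP (leqnSn n)).
  by apply: IH; apply: short_word.
by apply: word_graded_sum => //; apply/eqP; rewrite eqn_leq ge_wn -ltnS wn.
Qed.

Lemma graded_sum_total t : exists N, graded_sum E N t.
Proof.
move: t; apply: tv_ind => [|c x y [N xN] [N' yN']|w].
- by exists 0; apply: (graded_sum0 ker_sub0).
- exists (N + N')%N; apply: (graded_sumP ker_subP).
    exact: (graded_sum_widen ker_sub0 ker_subP (leq_addr N' N) xN).
  exact: (graded_sum_widen ker_sub0 ker_subP (leq_addl N N') yN').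
by exists (size w).+1; apply/short_graded_sum/short_word.
Qed.

Lemma ker_sub_direct N (h : nat -> TV V) : (forall n, E n (h n)) ->
  \sum_(n < N) h n = 0 -> forall n, (n < N)%N -> h n = 0.
Proof. by move=> Eh; apply: eigen_direct => // n; apply/ker_subE. Qed.

Definition tensor_grade n : tensor (TV V) (TV V) -> Prop :=
  Defs.span (fun x => exists i j (a b : TV V),
    [/\ (i + j)%N = n, E i a, E j b & x = tens a b]).

Lemma tensor_grade0 n : tensor_grade n 0.
Proof. exact: span0. Qed.

Lemma tensor_gradeP n c x y :
  tensor_grade n x -> tensor_grade n y -> tensor_grade n (c *: x + y).
Proof. by move=> x_n y_n; apply/spanD/y_n/spanZ. Qed.

Lemma tcoder_grade n x : tensor_grade n x -> tcoder D x = n%:R *: x.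
Proof.
elim=> [|c u y [i [j [a [b [<- /ker_subE Da /ker_subE Db ->]]]]] _ IH].
  by rewrite /tcoder scaler0 !(linear0 (tmap _ _)) addr0.
rewrite scalerDr -IH /tcoder !linearP /= addrACA; congr (_ + _).
rewrite -scalerDr !tmapE /= Da Db linearZl_LR linearZr_LR /= -scalerDl -natrD.
by rewrite !scalerA mulrC.
Qed.

Lemma tensor_graded_sum_total x : exists N, graded_sum tensor_grade N x.
Proof.
move: x; apply: tensor_ind => [|c x y [N xN] [N' yN']|s t].
- by exists 0; apply: (graded_sum0 tensor_grade0).
- exists (N + N')%N; apply: (graded_sumP tensor_gradeP).
    exact: (graded_sum_widen tensor_grade0 tensor_gradeP (leq_addr N' N) xN).
  exact: (graded_sum_widen tensor_grade0 tensor_gradeP (leq_addl N N') yN').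
have [N [h [Eh ->]]] := graded_sum_total s.
have [N' [k [Ek ->]]] := graded_sum_total t.
exists (N + N')%N; rewrite linear_sumlz.
apply: (graded_sum_sum tensor_grade0 tensor_gradeP) => i; rewrite linear_sumr.
apply: (graded_sum_sum tensor_grade0 tensor_gradeP) => j.
apply: (@graded_sum_single _ _ _ tensor_grade0 _ (i + j)).
  by have := ltn_ord i; have := ltn_ord j; lia.
by apply: span_gen; exists i, j, (h i), (k j).
Qed.

Lemma tcoder_is_linear : linear (tcoder D).
Proof. by rewrite /tcoder; lin. Qed.

HB.instance Definition _ :=
  GRing.isLinear.Build K _ _ _ (tcoder D) tcoder_is_linear.

(** The coproduct intertwines D with [tcoder D], which acts by k on total degree k. Hence [deconc t]
    is an eigenvector for n, and independence of eigenvectors kills its components of degree other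
    than n. *)
Lemma deconc_grade n t : E n t -> tensor_grade n (deconc t).
Proof.
move=> /ker_subE Dt; have [N0 sum_t] := tensor_graded_sum_total (deconc t).
(* Widening the sum guarantees that the index n occurs in it. *)
have [h [Th e]] := graded_sum_widen tensor_grade0 tensor_gradeP
  (leq_addl n.+1 N0) sum_t.
set N := (n.+1 + N0)%N in e; have nN : (n < N)%N.
  by rewrite /N addSn ltnS leq_addr.
suff h0 k : (k < N)%N -> k != n -> h k = 0.
  rewrite e (bigD1 (Ordinal nN)) //= big1 ?addr0 // => i ni; exact: h0.
move=> kN kn; apply/eqP.
(* The vectors (k - n) h_k are eigenvectors too, and their sum is [tcoder D - n] applied to
   [deconc t], which vanishes. *)
have: (k%:R - n%:R) *: h k = 0.
  apply: (@eigen_direct _ _ (tcoder D) charK N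
    (fun k => (k%:R - n%:R) *: h k)) kN.
    by move=> m; rewrite linearZ_LR /= (tcoder_grade (Th m)) !scalerA;
      congr (_ *: _); apply: mulrC.
  transitivity (tcoder D (deconc t) - n%:R *: deconc t).
    rewrite e linear_sum scaler_sumr -sumrB; apply: eq_bigr => i _.
    by rewrite scalerBl /= (tcoder_grade (Th i)).
  by rewrite -[tcoder D _]Dcoder Dt linearZ subrr.
move/eqP; rewrite scaler_eq0 => /orP[|//]; rewrite subr_eq0.
have natK_inj i j : (i < j)%N -> (i%:R == j%:R :> K) = false.
  move=> ij; rewrite eq_sym -subr_eq0 -natrB ?(ltnW ij) //.
  by rewrite ((pcharf0P K).1 charK) subn_eq0 leqNgt ij.
by case: ltngtP kn => // kn _; [|rewrite eq_sym]; rewrite natK_inj.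
Qed.

Lemma ker_subM i j s t : E i s -> E j t -> E (i + j)%N (s ⋆ t).
Proof.
move=> /ker_subE Ds /ker_subE Dt; apply/ker_subE.
by rewrite (coder_deriv charK Dcoder piD)
  Ds Dt linearZl_LR linearZr_LR /= -scalerDl natrD.
Qed.

Lemma ker_sub_one : E 0 one.
Proof. by apply/ker_subE; rewrite (coder1 Dcoder piD) scale0r. Qed.

Lemma counit_ker_sub n t : E n t -> n != 0%N -> counit t = 0.
Proof.
move=> /ker_subE Dt n0; have := counit_coder Dcoder t.
rewrite Dt linearZ /= => /eqP; rewrite mulf_eq0 ((pcharf0P K).1 charK)
  (negbTE n0).
by move/eqP.
Qed.

Lemma antipode_coder (S : {linear TV V -> TV V}) :
  conv S idfun =1 @unit_counit K V -> conv idfun S =1 @unit_counit K V ->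
  forall t, S (D t) = D (S t).
Proof.
move=> Sl Sr t.
pose SD := [the {linear TV V -> TV V} of S \o D].
pose DS := [the {linear TV V -> TV V} of D \o S].
have SDl (s : TV V) : conv SD idfun s + conv S D s = 0.
  transitivity (conv S idfun (D s)); last first.
    by rewrite Sl /unit_counit (counit_coder Dcoder) scale0r.
  rewrite /conv Dcoder !linearD /=; move: (deconc s).
  by apply: tensor_eq; [move=> x y; rewrite !tmapE | lin | lin].
have DSl (s : TV V) : conv DS idfun s + conv S D s = 0.
  transitivity (D (conv S idfun s)); last first.
    by rewrite Sl /unit_counit linearZ_LR /= (coder1 Dcoder piD) scaler0.
  rewrite /conv; move: (deconc s); apply: tensor_eq; [move=> x y | lin | lin].
  by rewrite !tmapE !tens_liftE /= (coder_deriv charK Dcoder piD).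
have SD_DS : conv SD idfun =1 conv DS idfun.
  by move=> s; apply: (@addIr _ (conv S D s)); rewrite SDl DSl.
(* Convolving on the right with [S], the inverse of the identity, cancels the identity. *)
rewrite -[LHS]/(SD t) -[RHS]/(DS t) -(conv_unitr SD) -(conv_unitr DS).
rewrite -!(conv_ext (frefl _) Sr) !convA.
exact: conv_ext.
Qed.

End EigenGrading.

(** * The graded Hopf algebra *)

Theorem corollary40 (K : fieldType) (V : comNUAlgType K)
    (charK : [pchar K] =i pred0) (D : {linear TV V -> TV V})
    (Dcoder : coderivation D)
    (piD : forall t : TV V,
       proj (D t) = series_map (series_mul (@series_1X K) (@series_ln1X K)) t) :
  exists S : {linear TV V -> TV V},
    graded_hopf_algebra (@qshuffle K V) (tv_one V) (@deconc K V) (@counit K V) S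
      (ker_sub D).
Proof.
have [S [Sl Sr]] := antipode_exists V; exists S; split.
- split.
  + exact: qshuffleA.
  + exact: qshuffle1l.
  + exact: qshuffle1r.
  + exact: deconc_coassoc.
  + exact: deconc_counitl.
  + exact: deconc_counitr.
  + exact: deconcM.
  + exact: deconc1.
  + exact: counitM.
  + exact: counit1.
  + exact: Sl.
  + exact: Sr.
- split.
  + exact: ker_sub0.
  + exact: ker_subP.
  + exact: graded_sum_total.
  + exact: ker_sub_direct.
- exact: ker_subM.
- exact: ker_sub_one.
- exact: deconc_grade.
- exact: counit_ker_sub.
- move=> n x /ker_subE Dx; apply/ker_subE.
  by rewrite -(antipode_coder charK Dcoder piD Sl Sr) Dx linearZ_LR.
Qed.
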